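(* The 22-term relation and the 34-term relation are equivalent in the sense that each one, together with its specializations, implies the other (up to the inversion and 3-term relations). Precisely: (i) For $K=\mathbb{Q}(a,b,c,t,u)$, the class in $V(K)$ of the 34-term element $f(a,b,c,t)-f(a,b,c,u)$ is a $\mathbb{Q}$-linear combination of classes of specializations in $K$ of the 22-term element $R_{22}$. (ii) For $K=\mathbb{Q}(t_1,t_2,t_3)$, the class in $V(K)$ of the 22-term element $R_{22}(t_1,t_2,t_3)$ is a $\mathbb{Q}$-linear combination of classes of specializations in $K$ of the 34-term element $f(a,b,c,t)-f(a,b,c,u)$.
   Context: For a field $K$ of characteristic $0$ let $\mathbb{Q}[\mathbb{P}^1(K)]$ be the $\mathbb{Q}$-vector space with basis the symbols $[x]$, $x\in\mathbb{P}^1(K)$. Let $V(K)$ be its quotient by the subspace spanned by $[0]$, $[\infty]$, all inversion relations $[x]-[1/x]$, and all 3-term relations $[x]+[1/(1-x)]+[1-1/x]-[1]$ (these are the elementary functional equations of the trilogarithm, modulo which one works). 22-term relation: let $t_1,t_2,t_3$ be independent variables and $t_4=(t_1t_2t_3)^{-1}$. The 22-term (Goncharov) element is $$R_{22}(t_1,t_2,t_3)=\sum_{i}[t_i]+\sum_{i\ne j}\Big[\frac{1-t_i}{1-t_j^{-1}}\Big]-\frac14\sum_{i\neq j}[t_it_j]-\frac18\sum_{\{i,j,k,l\}=\{1,2,3,4\}}\Big[\frac{(1-t_i)(1-t_j)}{(1-t_k^{-1})(1-t_l^{-1})}\Big]-3[1],$$ where $i,j$ run through $\{1,2,3,4\}$,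 sums over $i\ne j$ are over ordered pairs, and the last sum is over all $24$ orderings $(i,j,k,l)$ of $\{1,2,3,4\}$. 34-term relation: for independent variables $a,b,c,t$ put $$\begin{aligned}f(a,b,c,t)=&\Big[\tfrac{(1-ct)a}{a-t}\Big]+\Big[\tfrac{(1-ct)b}{b-t}\Big]+\Big[\tfrac{1-ct}{c(a-t)}\Big]+\Big[\tfrac{1-ct}{c(b-t)}\Big]\\&+\Big[\tfrac{abc-t}{(a-t)bc}\Big]+\Big[\tfrac{abc-t}{(b-t)ac}\Big]+\Big[\tfrac{abc-t}{a-t}\Big]+\Big[\tfrac{abc-t}{b-t}\Big]\\&+\Big[\tfrac{(a-t)b(ac-1)}{(b-t)a(bc-1)}\Big]+\Big[\tfrac{(t-a)(1-bc)}{(t-b)(1-ac)}\Big]+\Big[\tfrac{(tc-1)b(ac-1)}{(abc-t)(bc-1)}\Big]+\Big[\tfrac{(tc-1)a(bc-1)}{(abc-t)(ac-1)}\Big]\\&-\Big[\tfrac{(1-ct)abc}{abc-t}\Big]-\Big[\tfrac{1-ct}{(abc-t)c}\Big]-\Big[\tfrac{t-a}{t-b}\Big]-\Big[\tfrac{b(a-t)}{a(b-t)}\Big]-\Big[\tfrac{(b-t)(a-t)c}{(abc-t)(1-ct)}\Big].\end{aligned}$$ The 34-term element is $f(a,b,c,t)-f(a,b,c,u)$, with $a,b,c,t,u$ independent variables. A specialization in $K$ of one of these elements is the element of $\mathbb{Q}[\mathbb{P}^1(K)]$ obtained by substituting elements of $K$ for its variables, provided that every argument, in the factored form displayed, has a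 well-defined value in $\mathbb{P}^1(K)$ (values $0$ and $\infty$ being allowed). *)

(* Defs.v *)
From HB Require Import structures.
From mathcomp Require Import all_boot all_order all_fingroup all_algebra.
From mathcomp Require Import freeg mpoly.

Set Implicit Arguments.
Unset Strict Implicit.
Unset Printing Implicit Defensive.

Import GRing.Theory.
Local Open Scope ring_scope.

Section ProjectiveLine.
Variable K : fieldType.

Inductive P1 : Type := Fin of K | Infty.

Definition option_of_P1 (x : P1) : option K :=
  if x is Fin a then Some a else None.
Definition P1_of_option (x : option K) : P1 :=
  if x is Some a then Fin a else Infty.
Lemma option_of_P1K : cancel option_of_P1 P1_of_option.
Proof. by case. Qed.

HB.instance Definition _ := Choice.copy P1 (can_type option_of_P1K).

Definition pinv (x : P1) : P1 :=
  match x with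
  | Fin a => if a == 0 then Infty else Fin a^-1
  | Infty => Fin 0
  end.

(* x |-> 1 - x *)
Definition pcompl (x : P1) : P1 :=
  if x is Fin a then Fin (1 - a) else Infty.

(* Multiplication on P^1(K) is partial: [None] is the undefined value
   0 * oo.  Accordingly 0 / 0 and oo / oo are the undefined quotients. *)
Definition pmul (x y : P1) : option P1 :=
  match x, y with
  | Fin a, Fin b => Some (Fin (a * b))
  | Fin a, Infty | Infty, Fin a => if a == 0 then None else Some Infty
  | Infty, Infty => Some Infty
  end.

Definition pquot (x y : P1) : option P1 := pmul x (pinv y).

Definition opquot (x y : option P1) : option P1 :=
  if (x, y) is (Some x', Some y') then pquot x' y' else None.

(* Numerators and denominators that are polynomials in elements of K have
   finite factors, so the quotient is undefined exactly when n = d = 0. *)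
Definition quo (n d : K) : option P1 := pquot (Fin n) (Fin d).

End ProjectiveLine.

Arguments Infty {K}.

(* Q[P^1(K)], with basis the << x >> for x in P^1(K) *)
Notation QP1 K := {freeg (P1 K) / rat}.

Section Relations.
Variable K : fieldType.

Definition bas (x : P1 K) : QP1 K := << x >>.

Inductive elementary_relation : QP1 K -> Prop :=
| Rel_zero : elementary_relation (bas (Fin 0))
| Rel_infty : elementary_relation (bas Infty)
| Rel_inversion x : elementary_relation (bas x - bas (pinv x))
| Rel_three_term x : elementary_relation
    (bas x + bas (pinv (pcompl x)) + bas (pcompl (pinv x)) - bas (Fin 1)).

Definition in_span (S : QP1 K -> Prop) (v : QP1 K) : Prop :=
  exists n (q : 'I_n -> rat) (s : 'I_n -> QP1 K),
    (forall i, S (s i)) /\ v = \sum_i q i *: s i.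

(* equality of classes in V(K) = Q[P^1(K)] / span of elementary_relation *)
Definition Veq (v w : QP1 K) : Prop := in_span elementary_relation (v - w).

Definition class_in_span (S : QP1 K -> Prop) (v : QP1 K) : Prop :=
  exists2 w, in_span S w & Veq v w.

(* A formal combination sum_k q_k [x_k] whose arguments x_k are possibly
   undefined; it has a value only if every argument is defined. *)
Definition formal := seq (rat * option (P1 K)).

Definition value (ts : formal) : option (QP1 K) :=
  if all (fun qx => isSome qx.2) ts
  then Some (\sum_(qx <- ts) qx.1 *: oapp bas 0 qx.2)
  else None.

Definition with_coef (q : rat) (xs : seq (option (P1 K))) : formal :=
  [seq (q, x) | x <- xs].

Definition R22_points (t1 t2 t3 : K) : 4.-tuple (P1 K) :=
  [tuple Fin t1; Fin t2; Fin t3; pinv (Fin (t1 * t2 * t3))].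

Definition R22 (t1 t2 t3 : K) : formal :=
  let t := tnth (R22_points t1 t2 t3) in
  let o i := pcompl (t i) in
  let o' i := pcompl (pinv (t i)) in
  let neq := [seq ij <- enum {: 'I_4 * 'I_4} | ij.1 != ij.2] in
  with_coef 1 [seq Some (t i) | i <- enum 'I_4]
  ++ with_coef 1 [seq pquot (o ij.1) (o' ij.2) | ij <- neq]
  ++ with_coef (- (1 / 4%:R)) [seq pmul (t ij.1) (t ij.2) | ij <- neq]
  ++ with_coef (- (1 / 8%:R))
       [seq opquot (pmul (o (s (inord 0))) (o (s (inord 1))))
                  (pmul (o' (s (inord 2))) (o' (s (inord 3))))
       | s : 'S_4 <- enum {: 'S_4}]
  ++ with_coef (- 3%:R) [:: Some (Fin 1)].

Definition f34_pos (a b c t : K) : seq (option (P1 K)) :=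
  [:: quo ((1 - c * t) * a) (a - t);
      quo ((1 - c * t) * b) (b - t);
      quo (1 - c * t) (c * (a - t));
      quo (1 - c * t) (c * (b - t));
      quo (a * b * c - t) ((a - t) * b * c);
      quo (a * b * c - t) ((b - t) * a * c);
      quo (a * b * c - t) (a - t);
      quo (a * b * c - t) (b - t);
      quo ((a - t) * b * (a * c - 1)) ((b - t) * a * (b * c - 1));
      quo ((t - a) * (1 - b * c)) ((t - b) * (1 - a * c));
      quo ((t * c - 1) * b * (a * c - 1)) ((a * b * c - t) * (b * c - 1));
      quo ((t * c - 1) * a * (b * c - 1)) ((a * b * c - t) * (a * c - 1))].

Definition f34_neg (a b c t : K) : seq (option (P1 K)) :=
  [:: quo ((1 - c * t) * a * b * c) (a * b * c - t);
      quo (1 - c * t) ((a * b * c - t) * c);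
      quo (t - a) (t - b);
      quo (b * (a - t)) (a * (b - t));
      quo ((b - t) * (a - t) * c) ((a * b * c - t) * (1 - c * t))].

(* f(a,b,c,t) - f(a,b,c,u) *)
Definition R34 (a b c t u : K) : formal :=
  with_coef 1 (f34_pos a b c t) ++ with_coef (-1) (f34_neg a b c t)
  ++ with_coef (-1) (f34_pos a b c u) ++ with_coef 1 (f34_neg a b c u).

Definition specialization22 (v : QP1 K) : Prop :=
  exists t1 t2 t3 : K, value (R22 t1 t2 t3) = Some v.

Definition specialization34 (v : QP1 K) : Prop :=
  exists a b c t u : K, value (R34 a b c t u) = Some v.

End Relations.

(* the field Q(x_0, ..., x_(n-1)) and its generators *)
Definition ratfun (n : nat) : fieldType := {fraction {mpoly rat[n]}}.

Definition var (n : nat) (i : 'I_n) : ratfun n := tofrac 'X_i.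

(* Main.v *)
Require Import Defs.
From HB Require Import structures.
From mathcomp Require Import all_boot all_order all_fingroup all_algebra.
From mathcomp Require Import freeg mpoly ring.

Set Implicit Arguments.
Unset Strict Implicit.
Unset Printing Implicit Defensive.

Import GRing.Theory.
Local Open Scope ring_scope.

(** Everything rests on one identity in V(K).  With
      t1 = (1-bc)(a-t)/((1-ac)(b-t)),   t2 = a(1-bc)(b-t)/(b(1-ac)(a-t)),
      t3 = (1-ac)/(1-bc),               t4 = b(1-ac)/(a(1-bc)),
    whose product is 1, one has
      R22(t1,t2,t3) = f(a,b,c,t) - f(a,b,c,1/c)        ([R22_f34]).
    The parametrization makes every 1 - ti and 1 - 1/ti a product of the factors
    a-b, a-t, b-t, 1-ct, abc-t, 1-ac, 1-bc, a, b, c, so that the arguments of R22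
    cancel down to fractions in these factors.  Up to inversion, ten of the
    twelve arguments (1-ti)/(1-1/tj) and t1, t2 are the twelve positive
    arguments of f(a,b,c,t), while t1t3, t2t3 and the three quadruple arguments
    are the five negative ones.  What is left over in R22 involves only x = ac,
    y = bc and a/b.  On the other side, at t = 1/c the factor 1-ct vanishes, many
    terms of f become [0], [oo] or [1], and f(a,b,c,1/c) is what is left over,
    up to two 3-term relations ([three_term_pair]).

    (i) The points t3 and t4 do not depend on t.  Subtracting the identity for u
    from the identity for t eliminates f(a,b,c,1/c), so the 34-term element is a
    difference of two specializations of R22.

    (ii) Conversely, a rescaling of (a,b,c,t) leaves t1, ..., t4 unchanged, so one
    may take c = 1 and solve for a, b, t rationally in t1, t2, t3
    ([f34_parameters]).  Then R22 is the single specialization of the 34-term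
    element at (a, b, 1, t, 1).

    Both parts hold over any field away from the zero locus of a few explicit
    polynomials; the variables of a rational function field avoid that locus,
    as is seen by evaluating those polynomials at a rational point. *)

(** * Calculus of classes in V(K) *)

Section Classes.
Variable K : fieldType.
Implicit Types (S : QP1 K -> Prop) (v w : QP1 K) (x y : K).

Lemma in_span0 S : in_span S 0.
Proof.
by exists 0%N, (fun=> 0), (fun=> 0); split=> [[]|] //; rewrite big_ord0.
Qed.

Lemma in_span_gen S v : S v -> in_span S v.
Proof.
by move=> Sv; exists 1%N, (fun=> 1), (fun=> v); rewrite big_ord1 scale1r.
Qed.

Lemma in_spanZ S q v : in_span S v -> in_span S (q *: v).
Proof.
move=> [n [r [s [Ss ->]]]]; exists n, (fun i => q * r i), s; split=> //.
by rewrite scaler_sumr; apply: eq_bigr => i _; rewrite scalerA.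
Qed.

Lemma in_spanD S v w : in_span S v -> in_span S w -> in_span S (v + w).
Proof.
move=> [m [q [s [Ss ->]]]] [n [r [u [Su ->]]]].
exists (m + n)%N, (fun i => match split i with inl j => q j | inr k => r k end).
exists (fun i => match split i with inl j => s j | inr k => u k end); split.
  by move=> i; case: (split i).
rewrite big_split_ord /=; congr (_ + _); apply: eq_bigr => i _.
  by rewrite (unsplitK (inl i)).
by rewrite (unsplitK (inr i)).
Qed.

Lemma in_spanB S v w : in_span S v -> in_span S w -> in_span S (v - w).
Proof.
by move=> Sv Sw; rewrite -(scaleN1r w); apply: in_spanD Sv _; apply: in_spanZ.
Qed.

Lemma Veq_refl v : Veq v v.
Proof. by rewrite /Veq subrr; apply: in_span0. Qed.

Lemma Veq_sym v w : Veq v w -> Veq w v.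
Proof. by rewrite /Veq -(opprB v w) -(scaleN1r (v - w)); apply: in_spanZ. Qed.

Lemma Veq_trans v w u : Veq v w -> Veq w u -> Veq v u.
Proof. by rewrite /Veq => vw wu; rewrite -(subrKA w); apply: in_spanD. Qed.

Lemma VeqD v w v' w' : Veq v w -> Veq v' w' -> Veq (v + v') (w + w').
Proof. by rewrite /Veq opprD addrACA; apply: in_spanD. Qed.

Lemma VeqZ q v w : Veq v w -> Veq (q *: v) (q *: w).
Proof. by rewrite /Veq -scalerBr; apply: in_spanZ. Qed.

Lemma VeqB v w v' w' : Veq v w -> Veq v' w' -> Veq (v - v') (w - w').
Proof. by rewrite -!(scaleN1r v') -(scaleN1r w') => vw /(VeqZ (-1)); apply: VeqD. Qed.

(** Turns a congruence between long combinations into a linear identity over Q: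
    their difference only has to be displayed as a combination of known ones. *)
Lemma Veq_shift v w v' w' : Veq v' w' -> v - w = v' - w' -> Veq v w.
Proof. by rewrite /Veq => h ->. Qed.

Definition sym x : QP1 K := bas (Fin x).

Lemma sym0 : Veq (sym 0) 0.
Proof. by rewrite /Veq subr0; apply/in_span_gen/Rel_zero. Qed.

Lemma bas_infty : Veq (bas (@Infty K)) 0.
Proof. by rewrite /Veq subr0; apply/in_span_gen/Rel_infty. Qed.

(** As 0^-1 = 0 in K, the case y = 0 is trivial, although inversion in P^1(K)
    exchanges 0 and the point at infinity. *)
Lemma sym_inv x y : x = y^-1 -> Veq (sym x) (sym y).
Proof.
move=> ->; have [->|y0] := eqVneq y 0; first by rewrite invr0; apply: Veq_refl.
apply/Veq_sym/in_span_gen; rewrite /sym.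
by have := Rel_inversion (Fin y); rewrite /= (negPf y0).
Qed.

Lemma sym_three_term x y z : x != 0 -> x != 1 -> y = (1 - x)^-1 -> z = 1 - x^-1 ->
  Veq (sym x + sym y + sym z) (sym 1).
Proof.
move=> x0 x1 -> ->; apply: in_span_gen.
have := Rel_three_term (Fin x); rewrite /= (negPf x0) subr_eq0 eq_sym (negPf x1).
by [].
Qed.

End Classes.

(** Proves a Q-linear identity between combinations of atoms of Q[P^1(K)] by
    comparing the coefficients of each basis element. *)
Ltac lin := apply/eqP/freeg_eqP => ?;
  rewrite ?(coeffD, coeffB, coeffN, coeffZ, coeffMn, coeff0); field; done.

(** * Sums over indices, pairs and permutations of four points *)

Lemma sum_enum4 (V : zmodType) (G : nat -> V) :
  \sum_(i <- enum 'I_4) G i = G 0%N + G 1%N + G 2%N + G 3%N.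
Proof.
rewrite -(big_map val xpredT G) val_enum_ord !big_cons big_nil.
by rewrite addr0 !addrA.
Qed.

Lemma sum_pairs4 (V : zmodType) (G : nat -> nat -> V) :
  \sum_(p <- [seq p <- enum {: 'I_4 * 'I_4} | p.1 != p.2]) G p.1 p.2 =
  G 0%N 1%N + G 0%N 2%N + G 0%N 3%N + G 1%N 0%N + G 1%N 2%N + G 1%N 3%N
  + G 2%N 0%N + G 2%N 1%N + G 2%N 3%N + G 3%N 0%N + G 3%N 1%N + G 3%N 2%N.
Proof.
rewrite big_filter big_enum_cond /=.
rewrite -(pair_big_dep xpredT (fun i j : 'I_4 => i != j)
            (fun i j : 'I_4 => G i j)) /=.
rewrite (eq_bigr (fun i : 'I_4 => \sum_(j <- iota 0 4 | val i != j) G i j)).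
  rewrite -big_enum /= (sum_enum4 (fun i => \sum_(j <- iota 0 4 | i != j) G i j)).
  by rewrite !big_cons !big_nil /= !addr0 !addrA.
move=> i _; rewrite -val_enum_ord big_map big_enum_cond.
by apply: eq_bigl => j.
Qed.

(** The sum over S_4 becomes a sum over a list that evaluates to 24 explicit
    words: a permutation is determined by the word of its values. *)
Lemma sum_S4 (V : zmodType) (G : nat -> nat -> nat -> nat -> V) :
  \sum_(s <- enum {: 'S_4})
    G (s (inord 0)) (s (inord 1)) (s (inord 2)) (s (inord 3)) =
  \sum_(l <- permutations (iota 0 4))
    G (nth 0%N l 0%N) (nth 0%N l 1%N) (nth 0%N l 2%N) (nth 0%N l 3%N).
Proof.
pose word (s : 'S_4) := [seq val (s i) | i <- enum 'I_4].
have nth_word s k : (k < 4)%N -> nth 0%N (word s) k = s (inord k).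
  move=> k4; rewrite (nth_map (inord 0)) ?size_enum_ord //.
  congr (val (s _)); apply: val_inj; rewrite /= inordK //.
  by rewrite nth_enum_ord.
have wordsE : perm_eq [seq word s | s <- enum {: 'S_4}] (permutations (iota 0 4)).
  have word_inj : injective word.
    move=> s s' ss'; apply/permP => i; apply: val_inj.
    have := nth_word s i (ltn_ord i).
    by rewrite ss' nth_word // !inord_val.
  have wuniq : uniq [seq word s | s <- enum {: 'S_4}].
    by rewrite map_inj_uniq ?enum_uniq.
  have wsub : {subset [seq word s | s <- enum {: 'S_4}] <= permutations (iota 0 4)}.
    move=> l /mapP[s _ ->]; rewrite mem_permutations; apply: uniq_perm.
    - rewrite map_inj_uniq ?enum_uniq // => i j /val_inj; exact: perm_inj.
    - exact: iota_uniq.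
    move=> k; rewrite -val_enum_ord; apply/mapP/mapP => -[i _ ->].
      by exists (s i); rewrite ?mem_enum.
    by exists ((s^-1)%g i); rewrite ?mem_enum ?permKV.
  apply: (uniq_perm wuniq (permutations_uniq _)).
  apply: (uniq_min_size wuniq wsub _).2.
  by rewrite size_map -cardE card_Sn.
rewrite -(perm_big _ wordsE) [RHS]big_map; apply: eq_bigr => s _.
by rewrite !nth_word.
Qed.

(** * The 22-term element *)

Section Goncharov.
Variable K : fieldType.
Implicit Types (t : nat -> K).

Definition dbl t i j : K := (1 - t i) / (1 - (t j)^-1).
Definition quad t (i j k l : nat) : K :=
  (1 - t i) * (1 - t j) / ((1 - (t k)^-1) * (1 - (t l)^-1)).

Arguments dbl t (i j)%_nat_scope.
Arguments quad t (i j k l)%_nat_scope.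

(** As no ti is 0, 1 or infinity, the factors 1 - 1/tj in the denominators are
    finite and nonzero, so all arguments are finite points. *)
Lemma R22_value (t1 t2 t3 : K) (t := nth 0 [:: t1; t2; t3; (t1 * t2 * t3)^-1]) :
  (forall i, (i < 4)%N -> t i != 0 /\ t i != 1) ->
  value (R22 t1 t2 t3) = Some
    (\sum_(i <- enum 'I_4) sym (t i)
     + \sum_(p <- [seq p <- enum {: 'I_4 * 'I_4} | p.1 != p.2])
         sym (dbl t p.1 p.2)
     - (1 / 4%:R) *: (\sum_(p <- [seq p <- enum {: 'I_4 * 'I_4} | p.1 != p.2])
         sym (t p.1 * t p.2))
     - (1 / 8%:R) *: (\sum_(s <- enum {: 'S_4})
         sym (quad t (s (inord 0)) (s (inord 1)) (s (inord 2)) (s (inord 3))))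
     - 3%:R *: sym 1).
Proof.
move=> tN; have tI (i : 'I_4) : t i != 0 /\ t i != 1 by apply: tN.
have pt (i : 'I_4) : tnth (R22_points t1 t2 t3) i = Fin (t i).
  have [] := tN 3%N isT; rewrite /t /= invr_eq0 => t0 _.
  rewrite (tnth_nth Infty); case: i => [[|[|[|[|[]]]]]] //= _.
  by rewrite (negPf t0).
have opt i : pcompl (pinv (Fin (t (nat_of_ord (i : 'I_4))))) = Fin (1 - (t i)^-1).
  by rewrite /= (negPf (tI i).1).
have oN (i : 'I_4) : 1 - (t i)^-1 != 0.
  by rewrite subr_eq0 eq_sym invr_eq1 (tI i).2.
have E2 : [seq pquot (pcompl (tnth (R22_points t1 t2 t3) p.1))
                     (pcompl (pinv (tnth (R22_points t1 t2 t3) p.2)))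
          | p : 'I_4 * 'I_4 <- [seq p <- enum {: 'I_4 * 'I_4} | p.1 != p.2]]
        = [seq Some (Fin (dbl t p.1 p.2))
          | p : 'I_4 * 'I_4 <- [seq p <- enum {: 'I_4 * 'I_4} | p.1 != p.2]].
  apply: eq_map => p; rewrite !pt opt /pquot /= (negPf (oN _)).
  by [].
have E3 : [seq pmul (tnth (R22_points t1 t2 t3) p.1) (tnth (R22_points t1 t2 t3) p.2)
          | p : 'I_4 * 'I_4 <- [seq p <- enum {: 'I_4 * 'I_4} | p.1 != p.2]]
        = [seq Some (Fin (t p.1 * t p.2))
          | p : 'I_4 * 'I_4 <- [seq p <- enum {: 'I_4 * 'I_4} | p.1 != p.2]].
  by apply: eq_map => p; rewrite !pt.
have E4 (o := fun i => pcompl (tnth (R22_points t1 t2 t3) i))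
        (o' := fun i => pcompl (pinv (tnth (R22_points t1 t2 t3) i))) :
      [seq opquot (pmul (o (s (inord 0))) (o (s (inord 1))))
                  (pmul (o' (s (inord 2))) (o' (s (inord 3))))
       | s : 'S_4 <- enum {: 'S_4}]
    = [seq Some (Fin (quad t (s (inord 0)) (s (inord 1)) (s (inord 2)) (s (inord 3))))
       | s : 'S_4 <- enum {: 'S_4}].
  apply: eq_map => s; rewrite /o /o' !pt !opt /opquot /pquot /=.
  by rewrite mulf_eq0 (negPf (oN _)) (negPf (oN _)).
have allT T (P : pred T) r : (forall x, P x) -> all P r.
  by move=> PT; elim: r => //= x r ->; rewrite PT.
rewrite /R22 E2 E3 E4 /value /with_coef -!map_comp !all_cat !all_map.
rewrite [all _ [:: _]]/= !allT //; congr Some.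
rewrite !big_cat !big_map big_cons big_nil /= addr0 !addrA -?enumT.
rewrite !scaleNr !scaler_sumr -!sumrN.
congr (_ + _ + _ + _ + _).
- by apply: eq_bigr => i _; rewrite scale1r pt.
- by apply: eq_bigr => i _; rewrite scale1r.
- by apply: eq_bigr => i _; rewrite scaleNr.
- by apply: eq_bigr => i _; rewrite scaleNr.
Qed.

(** The 22 terms that give the element its name.  As t0 t1 t2 t3 = 1, the
    arguments ti tj and tk tl are inverse to each other, and so are the
    quadruple arguments attached to (ij, kl) and (kl, ij).  Hence the 12 ordered
    products give each of 3 classes four times, which cancels 1/4, and the 24
    orderings give each of 3 classes eight times, which cancels 1/8. *)
Lemma R22_terms (t1 t2 t3 : K) (t := nth 0 [:: t1; t2; t3; (t1 * t2 * t3)^-1]) :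
  (forall i, (i < 4)%N -> t i != 0 /\ t i != 1) ->
  exists2 v, value (R22 t1 t2 t3) = Some v &
  Veq v
   (sym (t 0%N) + sym (t 1%N) + sym (t 2%N) + sym (t 3%N)
    + (sym (dbl t 0 1) + sym (dbl t 0 2) + sym (dbl t 0 3)
       + sym (dbl t 1 0) + sym (dbl t 1 2) + sym (dbl t 1 3)
       + sym (dbl t 2 0) + sym (dbl t 2 1) + sym (dbl t 2 3)
       + sym (dbl t 3 0) + sym (dbl t 3 1) + sym (dbl t 3 2))
    - (sym (t 0%N * t 1%N) + sym (t 0%N * t 2%N) + sym (t 1%N * t 2%N))
    - (sym (quad t 0 1 2 3) + sym (quad t 0 2 1 3) + sym (quad t 1 2 0 3))
    - 3%:R *: sym 1).
Proof.
move=> tN; eexists; first exact: R22_value.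
have := tN 3%N isT; have := tN 2%N isT; have := tN 1%N isT; have := tN 0%N isT.
move=> [a0 a1] [b0 b1] [c0 c1] [d0 d1].
have t3E : t 3%N = (t 0%N * t 1%N * t 2%N)^-1 by [].
rewrite (sum_enum4 (fun i => sym (t i))).
rewrite (sum_pairs4 (fun i j => sym (dbl t i j))).
rewrite (sum_pairs4 (fun i j => sym (t i * t j))).
rewrite (sum_S4 (fun i j k l => sym (quad t i j k l))).
move: t t3E a0 a1 b0 b1 c0 c1 d0 d1 {tN} => t t3E a0 a1 b0 b1 c0 c1 d0 d1.
have mulC i j : t i * t j = t j * t i by exact: mulrC.
rewrite (mulC 1%N 0%N) (mulC 2%N 0%N) (mulC 3%N 0%N)
  (mulC 2%N 1%N) (mulC 3%N 1%N) (mulC 3%N 2%N).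
have quadC i j k l : quad t i j k l = quad t j i k l.
  by rewrite /quad (mulrC (1 - t i)).
have quadC' i j k l : quad t i j k l = quad t i j l k.
  by rewrite /quad (mulrC (1 - (t k)^-1)).
rewrite [permutations _](_ : _ =
  [:: [:: 1; 2; 0; 3]; [:: 2; 1; 0; 3]; [:: 0; 2; 1; 3];
      [:: 2; 0; 1; 3]; [:: 1; 0; 2; 3]; [:: 0; 1; 2; 3];
      [:: 1; 3; 0; 2]; [:: 3; 1; 0; 2]; [:: 0; 3; 1; 2];
      [:: 3; 0; 1; 2]; [:: 1; 0; 3; 2]; [:: 0; 1; 3; 2];
      [:: 3; 2; 0; 1]; [:: 2; 3; 0; 1]; [:: 0; 2; 3; 1];
      [:: 2; 0; 3; 1]; [:: 3; 0; 2; 1]; [:: 0; 3; 2; 1];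
      [:: 2; 1; 3; 0]; [:: 1; 2; 3; 0]; [:: 3; 1; 2; 0];
      [:: 1; 3; 2; 0]; [:: 2; 3; 1; 0]; [:: 3; 2; 1; 0]]%N) //.
rewrite !big_cons big_nil /=.
rewrite !(quadC 1%N 0%N) !(quadC 2%N 0%N) !(quadC 3%N 0%N) !(quadC 2%N 1%N)
  !(quadC 3%N 1%N) !(quadC 3%N 2%N).
rewrite !(quadC' _ _ 1%N 0%N) !(quadC' _ _ 2%N 0%N) !(quadC' _ _ 3%N 0%N)
  !(quadC' _ _ 2%N 1%N) !(quadC' _ _ 3%N 1%N) !(quadC' _ _ 3%N 2%N).
have m1 : Veq (sym (t 2%N * t 3%N)) (sym (t 0%N * t 1%N)).
  by apply: sym_inv; rewrite t3E; field; rewrite a0 b0 c0.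
have m2 : Veq (sym (t 1%N * t 3%N)) (sym (t 0%N * t 2%N)).
  by apply: sym_inv; rewrite t3E; field; rewrite a0 b0 c0.
have m3 : Veq (sym (t 0%N * t 3%N)) (sym (t 1%N * t 2%N)).
  by apply: sym_inv; rewrite t3E; field; rewrite a0 b0 c0.
have prod1 : t 0%N * t 1%N * t 2%N * t 3%N = 1.
  by rewrite t3E divff // !mulf_neq0.
have quad_swap i j k l : t i != 0 -> t j != 0 -> t k != 0 -> t l != 0 ->
    t i != 1 -> t j != 1 -> t k != 1 -> t l != 1 -> t i * t j * t k * t l = 1 ->
    Veq (sym (quad t k l i j)) (sym (quad t i j k l)).
  move=> i0 j0 k0 l0 i1 j1 k1 l1 p.
  apply/sym_inv/esym/mulr1_eq; rewrite -p /quad; field.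
  by rewrite i0 j0 k0 l0 !subr_eq0 i1 j1 k1 l1.
have q1 : Veq (sym (quad t 2 3 0 1)) (sym (quad t 0 1 2 3)) by apply: quad_swap.
have q2 : Veq (sym (quad t 1 3 0 2)) (sym (quad t 0 2 1 3)).
  by apply: quad_swap => //; rewrite -prod1; ring.
have q3 : Veq (sym (quad t 0 3 1 2)) (sym (quad t 1 2 0 3)).
  by apply: quad_swap => //; rewrite -prod1; ring.
apply: (Veq_shift (VeqZ (- (1 / 2%:R))
  (VeqD (VeqD (VeqD (VeqD (VeqD m1 m2) m3) q1) q2) q3))); lin.
Qed.

End Goncharov.

(** * The 34-term element *)

Lemma neq0_up_to_sign (R : zmodType) (x y : R) : x != 0 -> y = x \/ y = - x -> y != 0.
Proof. by move=> x0 [] ->; rewrite ?oppr_eq0. Qed.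

(** Discharges the nonvanishing conditions of [field], whose factors agree with the
    hypotheses only up to sign and to the order of the monomials. *)
Ltac neq0 := repeat (apply/andP; split);
  try assumption; match goal with h : is_true (negb (eq_op ?x _)) |- _ =>
    apply: (neq0_up_to_sign h); first [left; ring | right; ring]
  end.

Section F34.
Variable K : fieldType.
Implicit Types a b c t u : K.

(** Undefined arguments are counted as 0, so that f is a total function. *)
Definition f34 a b c t : QP1 K :=
  \sum_(x <- f34_pos a b c t) oapp (@bas K) 0 x
  - \sum_(x <- f34_neg a b c t) oapp (@bas K) 0 x.

Definition f34_defined a b c t : bool :=
  all isSome (f34_pos a b c t ++ f34_neg a b c t).

Lemma R34_value a b c t u : f34_defined a b c t -> f34_defined a b c u ->
  value (R34 a b c t u) = Some (f34 a b c t - f34 a b c u).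
Proof.
have sum_coef q xs : \sum_(qx <- with_coef q xs) qx.1 *: oapp (@bas K) 0 qx.2
    = q *: \sum_(x <- xs) oapp (@bas K) 0 x.
  by rewrite big_map scaler_sumr.
have all_coef q (xs : seq (option (P1 K))) :
    all (fun qx : rat * option (P1 K) => isSome qx.2) (with_coef q xs) = all isSome xs.
  by rewrite all_map.
rewrite /f34_defined !all_cat => /andP[tp tn] /andP[up un].
rewrite /value /R34 !all_cat !all_coef tp tn up un; congr Some.
rewrite !big_cat !sum_coef /f34 !scale1r !scaleN1r /= opprB.
by rewrite [in RHS](addrC (bigop _ (f34_neg a b c u) _)) !addrA.
Qed.

Lemma quoE (n d : K) : d != 0 -> quo n d = Some (Fin (n / d)).
Proof. by rewrite /quo /pquot /= => /negPf->. Qed.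

Lemma quo_infty (n : K) : n != 0 -> quo n 0 = Some Infty.
Proof. by rewrite /quo /pquot /= eqxx => /negPf->. Qed.

(** The last condition says that abc - t does not vanish at t = 1/c, which is
    what makes f(a,b,c,1/c) well defined. *)
Definition generic a b c t : bool :=
  [&& a != 0, b != 0, c != 0, a - b != 0, 1 - a * c != 0, 1 - b * c != 0,
      a - t != 0, b - t != 0, 1 - c * t != 0, a * b * c - t != 0
    & a * b * c * c - 1 != 0].

(** With A the first argument, the other two are 1/(1-A) and the inverse of
    1 - 1/A.  For x = ac and y = bc the outer two are arguments of f(a,b,c,1/c)
    and the middle one is an argument of R22, up to inversion. *)
Lemma three_term_pair (x y : K) : x != 0 -> y != 0 ->
    1 - x != 0 -> 1 - y != 0 -> 1 - x * y != 0 ->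
  Veq (sym ((x * y - 1) / ((x - 1) * y)) + sym (y * (x - 1) / (1 - y))
       + sym ((x * y - 1) / (y - 1))) (sym 1).
Proof.
move=> x0 y0 x1 y1 xy1; set A := _ / (_ * y).
have nz n e : n != 0 -> e != 0 -> n / e != 0 :> K.
  by move=> n0 e0; rewrite mulf_neq0 ?invr_eq0.
have x1' : x - 1 != 0 by neq0.
have xy1' : x * y - 1 != 0 by neq0.
have A0 : A != 0 by rewrite nz ?mulf_neq0.
have A1 : 1 - A = (1 - y) / ((x - 1) * y) by rewrite /A; field; neq0.
have A2 : A != 1.
  by rewrite eq_sym -subr_eq0 A1 nz ?mulf_neq0.
have A3 : (1 - A)^-1 = y * (x - 1) / (1 - y) by rewrite A1; field; neq0.
have A4 : Veq (sym (1 - A^-1)) (sym ((x * y - 1) / (y - 1))).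
  by apply: sym_inv; rewrite /A; field; neq0.
apply: (Veq_shift (VeqB (sym_three_term A0 A2 (esym A3) (erefl _)) A4)); lin.
Qed.

Lemma f34_generic a b c t : generic a b c t ->
  f34_defined a b c t /\
  f34 a b c t =
    sym ((1 - c * t) * a / (a - t)) + sym ((1 - c * t) * b / (b - t))
  + sym ((1 - c * t) / (c * (a - t))) + sym ((1 - c * t) / (c * (b - t)))
  + sym ((a * b * c - t) / ((a - t) * b * c))
  + sym ((a * b * c - t) / ((b - t) * a * c))
  + sym ((a * b * c - t) / (a - t)) + sym ((a * b * c - t) / (b - t))
  + sym ((a - t) * b * (a * c - 1) / ((b - t) * a * (b * c - 1)))
  + sym ((t - a) * (1 - b * c) / ((t - b) * (1 - a * c)))
  + sym ((t * c - 1) * b * (a * c - 1) / ((a * b * c - t) * (b * c - 1)))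
  + sym ((t * c - 1) * a * (b * c - 1) / ((a * b * c - t) * (a * c - 1)))
  - (sym ((1 - c * t) * a * b * c / (a * b * c - t))
  + sym ((1 - c * t) / ((a * b * c - t) * c))
  + sym ((t - a) / (t - b)) + sym (b * (a - t) / (a * (b - t)))
  + sym ((b - t) * (a - t) * c / ((a * b * c - t) * (1 - c * t)))).
Proof.
case/and5P=> a0 b0 c0 ab /and5P[ac bc at0 bt /and3P[ct wt _]].
have ac' : a * c - 1 != 0 by rewrite -opprB oppr_eq0.
have bc' : b * c - 1 != 0 by rewrite -opprB oppr_eq0.
have tb : t - b != 0 by rewrite -opprB oppr_eq0.
rewrite /f34_defined /f34 /f34_pos /f34_neg.
do !rewrite [quo _ _]quoE; do ?[by rewrite !mulf_neq0]; do ?[by []].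
by split=> //; rewrite !big_cons !big_nil /= !addr0 !addrA.
Qed.

(** At t = 1/c the factor 1 - ct kills the terms 1 to 4, 11 and 12 and the first
    two negative ones, the last one is infinite, and the tenth is [1]. *)
Lemma f34_at_invc a b c :
  a != 0 -> b != 0 -> c != 0 -> 1 - a * c != 0 -> 1 - b * c != 0 ->
  a * b * c * c - 1 != 0 ->
  f34_defined a b c c^-1 /\
  Veq (f34 a b c c^-1)
    (sym ((a * c * (b * c) - 1) / ((a * c - 1) * (b * c)))
     + sym ((a * c * (b * c) - 1) / ((b * c - 1) * (a * c)))
     + sym ((a * c * (b * c) - 1) / (a * c - 1))
     + sym ((a * c * (b * c) - 1) / (b * c - 1))
     + sym (a * (1 - b * c) ^+ 2 / (b * (1 - a * c) ^+ 2)) + sym 1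
     - (sym ((1 - a * c) / (1 - b * c))
        + sym (b * (1 - a * c) / (a * (1 - b * c))))).
Proof.
move=> a0 b0 c0 x1 y1 xy.
have x1' : a * c - 1 != 0 by rewrite -opprB oppr_eq0.
have y1' : b * c - 1 != 0 by rewrite -opprB oppr_eq0.
have eat : a - c^-1 = (a * c - 1) / c by field.
have ebt : b - c^-1 = (b * c - 1) / c by field.
have eta : c^-1 - a = (1 - a * c) / c by field.
have etb : c^-1 - b = (1 - b * c) / c by field.
have ect : 1 - c * c^-1 = 0 by rewrite divff // subrr.
have etc : c^-1 * c - 1 = 0 by rewrite mulVf // subrr.
have ew : a * b * c - c^-1 = (a * c * (b * c) - 1) / c by field.
have xy' : a * c * (b * c) - 1 != 0 by rewrite mulrACA mulrA.
rewrite /f34_defined /f34 /f34_pos /f34_neg eat ebt eta etb ect etc ew.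
rewrite !mul0r !mulr0.
have ci : c^-1 != 0 by rewrite invr_eq0.
rewrite quo_infty; last by rewrite !mulf_neq0.
do !rewrite [quo _ _]quoE; do ?[by rewrite !mulf_neq0]; do ?[by []].
split=> //; rewrite !big_cons !big_nil /= !mul0r !addr0.
have eA : (a * c * (b * c) - 1) / c / ((a * c - 1) / c * b * c)
  = (a * c * (b * c) - 1) / ((a * c - 1) * (b * c)).
  by field; neq0.
have eB : (a * c * (b * c) - 1) / c / ((b * c - 1) / c * a * c)
  = (a * c * (b * c) - 1) / ((b * c - 1) * (a * c)).
  by field; neq0.
have eC : (a * c * (b * c) - 1) / c / ((a * c - 1) / c)
  = (a * c * (b * c) - 1) / (a * c - 1) by field; neq0.
have eD : (a * c * (b * c) - 1) / c / ((b * c - 1) / c)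
  = (a * c * (b * c) - 1) / (b * c - 1) by field; neq0.
have e1 : (1 - a * c) / c * (1 - b * c) / ((1 - b * c) / c * (1 - a * c)) = 1.
  by field; neq0.
have e3 : (1 - a * c) / c / ((1 - b * c) / c) = (1 - a * c) / (1 - b * c).
  by field; neq0.
have e4 : b * ((a * c - 1) / c) / (a * ((b * c - 1) / c))
  = b * (1 - a * c) / (a * (1 - b * c)).
  by field; neq0.
have ez : Veq
    (sym ((a * c - 1) / c * b * (a * c - 1) / ((b * c - 1) / c * a * (b * c - 1))))
    (sym (a * (1 - b * c) ^+ 2 / (b * (1 - a * c) ^+ 2))).
  by apply: sym_inv; field; neq0.
rewrite {}eA {}eB {}eC {}eD {}e1 {}e3 {}e4.
(* [0] occurs six times with sign + and twice with sign -. *)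
apply: (Veq_shift (VeqD (VeqB (VeqZ 4%:R (sym0 K)) (bas_infty K)) ez)).
rewrite /sym; lin.
Qed.

(** * The identity between the two elements *)

(** The key identity.  The arguments of R22 that equal one of f(a,b,c,t) on the
    nose are rewritten; those that are its inverse are moved to the right by an
    inversion relation; t1t2, t3, t4 and the arguments built on (t3,t4) and
    (t4,t3) account for f(a,b,c,1/c) by means of two 3-term relations. *)
Lemma R22_f34 a b c t :
    let t1 := (1 - b * c) * (a - t) / ((1 - a * c) * (b - t)) in
    let t2 := a * (1 - b * c) * (b - t) / (b * (1 - a * c) * (a - t)) in
    let t3 := (1 - a * c) / (1 - b * c) in
    generic a b c t ->
  exists2 v, value (R22 t1 t2 t3) = Some v
           & Veq v (f34 a b c t - f34 a b c c^-1).
Proof.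
move=> t1 t2 t3 gen; case/and5P: (gen) => a0 b0 c0 ab.
case/and5P=> ac bc at0 bt /and3P[ct wt xy].
pose t4 := b * (1 - a * c) / (a * (1 - b * c)).
have [_ ->] := f34_generic gen.
have [_ finv] := f34_at_invc a0 b0 c0 ac bc xy.
have t4E : (t1 * t2 * t3)^-1 = t4 by rewrite /t1 /t2 /t3 /t4; field; neq0.
have o1 : 1 - t1 = (b - a) * (1 - c * t) / ((1 - a * c) * (b - t)).
  by rewrite /t1; field; neq0.
have o2 : 1 - t2 = (a - b) * (t - a * b * c) / (b * (1 - a * c) * (a - t)).
  by rewrite /t2; field; neq0.
have o3 : 1 - t3 = c * (a - b) / (1 - b * c) by rewrite /t3; field; neq0.
have o4 : 1 - t4 = (a - b) / (a * (1 - b * c)) by rewrite /t4; field; neq0.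
have p1 : 1 - t1^-1 = (a - b) * (1 - c * t) / ((1 - b * c) * (a - t)).
  by rewrite /t1; field; neq0.
have p2 : 1 - t2^-1 = (a - b) * (a * b * c - t) / (a * (1 - b * c) * (b - t)).
  by rewrite /t2; field; neq0.
have p3 : 1 - t3^-1 = c * (b - a) / (1 - a * c) by rewrite /t3; field; neq0.
have p4 : 1 - t4^-1 = (b - a) / (b * (1 - a * c)) by rewrite /t4; field; neq0.
have tN i : (i < 4)%N -> nth 0 [:: t1; t2; t3; t4] i != 0
                         /\ nth 0 [:: t1; t2; t3; t4] i != 1.
  have neq1 x : 1 - x != 0 -> x != 1 :> K by rewrite subr_eq0 eq_sym.
  have nz n d : n != 0 -> d != 0 -> n / d != 0 :> K.
    by move=> n0 d0; rewrite mulf_neq0 ?invr_eq0.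
  case: i => [|[|[|[|//]]]] _ /=; split; try apply: neq1; rewrite ?o1 ?o2 ?o3 ?o4;
  apply: nz; rewrite ?mulf_neq0 //; neq0.
have tN' i : (i < 4)%N -> nth 0 [:: t1; t2; t3; (t1 * t2 * t3)^-1] i != 0
    /\ nth 0 [:: t1; t2; t3; (t1 * t2 * t3)^-1] i != 1 by rewrite t4E; apply: tN.
have [v ev vE] := R22_terms tN'.
exists v => //; apply: (Veq_trans vE); rewrite t4E /=.
have w0 : 1 - a * c * (b * c) != 0 by neq0.
have w0' : 1 - b * c * (a * c) != 0 by neq0.
set d := dbl _; set q := quad _.
have d01 : d 0 1 = (t * c - 1) * a * (b * c - 1) / ((a * b * c - t) * (a * c - 1)).
  by rewrite /d /dbl /= o1 p2; field; neq0.
have d10 : Veq (sym (d 1 0))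
    (sym ((t * c - 1) * b * (a * c - 1) / ((a * b * c - t) * (b * c - 1)))).
  by apply: sym_inv; rewrite /d /dbl /= o2 p1; field; neq0.
have d02 : d 0 2 = (1 - c * t) / (c * (b - t)).
  by rewrite /d /dbl /= o1 p3; field; neq0.
have d20 : Veq (sym (d 2 0)) (sym ((1 - c * t) / (c * (a - t)))).
  by apply: sym_inv; rewrite /d /dbl /= o3 p1; field; neq0.
have d03 : d 0 3 = (1 - c * t) * b / (b - t).
  by rewrite /d /dbl /= o1 p4; field; neq0.
have d30 : Veq (sym (d 3 0)) (sym ((1 - c * t) * a / (a - t))).
  by apply: sym_inv; rewrite /d /dbl /= o4 p1; field; neq0.
have d12 : d 1 2 = (a * b * c - t) / ((a - t) * b * c).
  by rewrite /d /dbl /= o2 p3; field; neq0.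
have d21 : Veq (sym (d 2 1)) (sym ((a * b * c - t) / ((b - t) * a * c))).
  by apply: sym_inv; rewrite /d /dbl /= o3 p2; field; neq0.
have d13 : d 1 3 = (a * b * c - t) / (a - t).
  by rewrite /d /dbl /= o2 p4; field; neq0.
have d31 : Veq (sym (d 3 1)) (sym ((a * b * c - t) / (b - t))).
  by apply: sym_inv; rewrite /d /dbl /= o4 p2; field; neq0.
have h1 : t1 = (t - a) * (1 - b * c) / ((t - b) * (1 - a * c)).
  by rewrite /t1; field; neq0.
have h2 : Veq (sym t2) (sym ((a - t) * b * (a * c - 1) / ((b - t) * a * (b * c - 1)))).
  by apply: sym_inv; rewrite /t2; field; neq0.
have h12 : t1 * t2 = a * (1 - b * c) ^+ 2 / (b * (1 - a * c) ^+ 2).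
  by rewrite /t1 /t2; field; neq0.
have h13 : t1 * t3 = (t - a) / (t - b) by rewrite /t1 /t3; field; neq0.
have h23 : Veq (sym (t2 * t3)) (sym (b * (a - t) / (a * (b - t)))).
  by apply: sym_inv; rewrite /t2 /t3; field; neq0.
have q01 : Veq (sym (q 0 1 2 3))
    (sym ((b - t) * (a - t) * c / ((a * b * c - t) * (1 - c * t)))).
  by apply: sym_inv; rewrite /q /quad /= o1 o2 p3 p4; field; neq0.
have q02 : q 0 2 1 3 = (1 - c * t) * a * b * c / (a * b * c - t).
  by rewrite /q /quad /= o1 o3 p2 p4; field; neq0.
have q12 : Veq (sym (q 1 2 0 3)) (sym ((1 - c * t) / ((a * b * c - t) * c))).
  by apply: sym_inv; rewrite /q /quad /= o2 o3 p1 p4; field; neq0.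
have d23 : d 2 3 = b * c * (a * c - 1) / (1 - b * c).
  by rewrite /d /dbl /= o3 p4; field; neq0.
have d32 : Veq (sym (d 3 2)) (sym (a * c * (b * c - 1) / (1 - a * c))).
  by apply: sym_inv; rewrite /d /dbl /= o4 p3; field; neq0.
have tA := three_term_pair (mulf_neq0 a0 c0) (mulf_neq0 b0 c0) ac bc w0.
have tB := three_term_pair (mulf_neq0 b0 c0) (mulf_neq0 a0 c0) bc ac w0'.
rewrite (mulrC (b * c)) in tB.
rewrite {}d01 {}d02 {}d03 {}d12 {}d13 {}h12 {}h13 {}h1 {}q02 {}d23.
(* The negative terms that match up to inversion enter with the opposite sign. *)
have inv_pos := VeqD (VeqD (VeqD h2 d10) (VeqD d20 d30)) (VeqD (VeqD d21 d31) d32).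
have inv_neg := VeqD h23 (VeqD q01 q12).
apply: (Veq_shift (VeqD (VeqB inv_pos inv_neg) (VeqD finv (VeqD tA tB)))).
rewrite /t4 /t3; lin.
Qed.
End F34.

(** * Each element in terms of the other *)

Lemma R34_in_span_R22 (K : fieldType) (a b c t u : K) :
    generic a b c t -> generic a b c u ->
  exists2 v, value (R34 a b c t u) = Some v
           & class_in_span (@specialization22 K) v.
Proof.
move=> gt gu; exists (f34 a b c t - f34 a b c u).
  by rewrite R34_value ?(f34_generic gt).1 ?(f34_generic gu).1.
have [vt Evt Vt] := R22_f34 gt; have [vu Evu Vu] := R22_f34 gu.
exists (vt - vu); first by
  apply: in_spanB; apply: in_span_gen; do 3!eexists; eassumption.
by apply: Veq_sym; have := VeqB Vt Vu; rewrite (opprB (f34 a b c u)) addrA subrK.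
Qed.

(** With c = 1, the equation a/b = t3/t4 and the definition of t3 determine a and
    b, and the definition of t1, linear in t, then determines t.  All the
    quantities in [generic] factor into the ten polynomials of the hypotheses. *)
Lemma f34_parameters (K : fieldType) (t1 t2 t3 : K) :
  t1 != 0 -> t2 != 0 -> t3 != 0 -> 1 - t1 != 0 -> 1 - t2 != 0 -> 1 - t3 != 0 ->
  1 - t1 * t2 != 0 -> 1 - t1 * t3 != 0 -> 1 - t1 * t2 * t3 != 0 ->
  1 - t1 * t2 * t3 * t3 != 0 ->
  exists a b t : K,
    [/\ generic a b 1 t,
        (1 - b * 1) * (a - t) / ((1 - a * 1) * (b - t)) = t1,
        a * (1 - b * 1) * (b - t) / (b * (1 - a * 1) * (a - t)) = t2
      & (1 - a * 1) / (1 - b * 1) = t3].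
Proof.
move=> t10 t20 t30 t11 t21 t31 t12 t13 p1 pt.
pose p := t1 * t2 * t3.
pose a := (t3 - 1) * p / (1 - p); pose b := (t3 - 1) / (t3 * (1 - p)).
pose t := (t3 - 1) * (p - t1) / ((1 - p) * (1 - t1 * t3)).
have ea : 1 - a * 1 = (1 - p * t3) / (1 - p) by rewrite /a /p; field; neq0.
have eb : 1 - b * 1 = (1 - p * t3) / (t3 * (1 - p)).
  by rewrite /b /p; field; neq0.
have ab : a - b = (t3 - 1) * (p * t3 - 1) / (t3 * (1 - p)).
  by rewrite /a /b /p; field; neq0.
have at_ : a - t = (t3 - 1) * t1 * (1 - p * t3) / ((1 - p) * (1 - t1 * t3)).
  by rewrite /a /t /p; field; neq0.
have bt : b - t = (t3 - 1) * (1 - p * t3) / (t3 * (1 - p) * (1 - t1 * t3)).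
  by rewrite /b /t /p; field; neq0.
have ct : 1 - 1 * t = (1 - t1) * (1 - p * t3) / ((1 - p) * (1 - t1 * t3)).
  by rewrite /t /p; field; neq0.
have abt : a * b * 1 - t
    = (t3 - 1) * t1 * (t2 - 1) * (p * t3 - 1) / ((1 - p) ^+ 2 * (1 - t1 * t3)).
  by rewrite /a /b /t /p; field; neq0.
have ab1 : a * b * 1 * 1 - 1 = (p * t3 - 1) * (1 - t1 * t2) / (1 - p) ^+ 2.
  by rewrite /a /b /p; field; neq0.
have nz n d : n != 0 -> d != 0 -> n / d != 0 :> K.
  by move=> n0 d0; rewrite mulf_neq0 ?invr_eq0.
have p0 : p != 0 by rewrite !mulf_neq0.
have t31' : t3 - 1 != 0 by neq0.
have t21' : t2 - 1 != 0 by neq0.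
have pt' : p * t3 - 1 != 0 by rewrite /p; neq0.
exists a, b, t; rewrite /generic ea eb ab at_ bt ct abt ab1; split.
- by rewrite oner_eq0 !nz ?mulf_neq0 ?expf_neq0.
- by rewrite /p; field; neq0.
- by rewrite /a /b /p; field; neq0.
- by rewrite /p; field; neq0.
Qed.

Lemma R22_in_span_R34 (K : fieldType) (t1 t2 t3 : K) :
  t1 != 0 -> t2 != 0 -> t3 != 0 -> 1 - t1 != 0 -> 1 - t2 != 0 -> 1 - t3 != 0 ->
  1 - t1 * t2 != 0 -> 1 - t1 * t3 != 0 -> 1 - t1 * t2 * t3 != 0 ->
  1 - t1 * t2 * t3 * t3 != 0 ->
  exists2 v, value (R22 t1 t2 t3) = Some v
           & class_in_span (@specialization34 K) v.
Proof.
move=> t10 t20 t30 t11 t21 t31 t12 t13 p1 pt.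
have [a [b [t [gen e1 e2 e3]]]] := f34_parameters t10 t20 t30 t11 t21 t31 t12 t13 p1 pt.
have [v] := R22_f34 gen; rewrite {}e1 {}e2 {}e3 => Ev V; exists v => //.
exists (f34 a b 1 t - f34 a b 1 1^-1) => //; apply: in_span_gen.
exists a, b, 1, t, 1^-1; apply: R34_value; first exact: (f34_generic gen).1.
case/and5P: (gen) => a0 b0 c0 _ /and5P[ac bc _ _ /and3P[_ _ xy]].
exact: (f34_at_invc a0 b0 c0 ac bc xy).1.
Qed.

(** * Rational function fields *)

Lemma ratfun_neq0 n (p : {mpoly rat[n]}) (x : 'I_n -> rat) :
  p.@[x] != 0 -> tofrac p != 0 :> ratfun n.
Proof. by rewrite tofrac_eq0; apply: contraNneq => ->; rewrite meval0. Qed.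

(** Pulls an element of the rational function field back to a polynomial and
    shows that it is not 0 by its value at the point with coordinates x. *)
Ltac neq0_at x :=
  rewrite /var -?[1 in 1 - _]tofrac1 -?[1 in _ - 1]tofrac1 -?tofracM -?tofracB;
  apply: (@ratfun_neq0 _ _ (fun i => nth 0 x i));
  rewrite ?(mevalB, mevalM, meval1, mevalXU) ?inordK //.

Theorem proposition3p6 :
  (let x (i : 'I_5) : ratfun 5 := var i in
   exists2 v : QP1 (ratfun 5),
     value (R34 (x (inord 0)) (x (inord 1)) (x (inord 2))
                (x (inord 3)) (x (inord 4))) = Some v
     & class_in_span (@specialization22 (ratfun 5)) v)
  /\
  (let x (i : 'I_3) : ratfun 3 := var i in
   exists2 v : QP1 (ratfun 3),
     value (R22 (x (inord 0)) (x (inord 1)) (x (inord 2))) = Some v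
     & class_in_span (@specialization34 (ratfun 3)) v).
Proof.
split=> x.
  by apply: R34_in_span_R22; rewrite /generic; do !(apply/andP; split);
    neq0_at [:: 2%:R; 3%:R; 5%:R; 7%:R; 11%:R : rat].
by apply: R22_in_span_R34; neq0_at [:: 2%:R; 3%:R; 5%:R : rat].
Qed.
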